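(* Let $A\in M_k\otimes M_m$ be a positive semidefinite Hermitian matrix with a Hermitian Schmidt decomposition $A=\sum_{i=1}^n\lambda_i\gamma_i\otimes\delta_i$, where $\lambda_1\geq\dots\geq\lambda_n>0$. Then $A$ is weak irreducible if the following three conditions hold: 1. $\lambda_1>\lambda_2\geq\dots\geq\lambda_n>0$; 2. $\Im(\gamma_i)\subset\Im(\gamma_1)$ for $1\leq i\leq n$; 3. $\Im(\delta_i)\subset\Im(\delta_1)$ for $1\leq i\leq n$.
   Context: $M_k$ denotes the complex $k\times k$ matrices, and $M_k\otimes M_m$ is identified with $M_{km}$ via the Kronecker product. $M_k$ carries the inner product $\langle C,D\rangle=\mathrm{tr}(CD^* )$. $\Im(X)$ denotes the image (column space) of a matrix $X$. A Hermitian projection is an orthogonal projection matrix. A Hermitian Schmidt decomposition of a Hermitian $A\in M_k\otimes M_m$ is an expression $A=\sum_{i=1}^n\lambda_i\gamma_i\otimes\delta_i$ with real $\lambda_i>0$, where $\{\gamma_1,\dots,\gamma_n\}\subset M_k$ and $\{\delta_1,\dots,\delta_n\}\subset M_m$ are orthonormal sets of Hermitian matrices. A positive semidefinite Hermitian matrix $A\in M_k\otimes M_m$ is weak irreducible if, for all Hermitian projections $V_1,V_2\in M_k$ and $W_1,W_2\in M_m$ with $V_1V_2=0$, $W_1W_2=0$, $V_1+V_2=Id\in M_k$ and $W_1+W_2=Id\in M_m$, the equality $A=\sum_{i=1}^2(V_i\otimes W_i)A(V_i\otimes W_i)$ implies that $(V_1\otimes W_1)A(V_1\otimes W_1)=0$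 or $(V_2\otimes W_2)A(V_2\otimes W_2)=0$. *)

(* Defs.v *)
From mathcomp Require Import all_boot all_order all_algebra.
From mathcomp Require Import complex mxtens.
From mathcomp Require Import classical_sets reals.

Set Implicit Arguments.
Unset Strict Implicit.
Unset Printing Implicit Defensive.

Import Order.TTheory GRing.Theory Num.Theory.
Local Open Scope ring_scope.
Local Open Scope complex_scope.
Local Open Scope sesquilinear_scope.
Local Open Scope classical_set_scope.

(* On R[i] the order is partial: [0 <= z] means that z is real and
   nonnegative. *)
Definition psd_hermitian (R : realType) (n : nat) (A : 'M[R[i]]_n) : Prop :=
  A \is hermsymmx /\
  forall v : 'cV[R[i]]_n, 0 <= (v ^t* *m A *m v) 0 0.

Definition hermitian_projection (R : realType) (n : nat) (P : 'M[R[i]]_n)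
    : Prop :=
  P \is hermsymmx /\ P *m P = P.

Definition mx_image (R : realType) (m n : nat) (X : 'M[R[i]]_(m, n))
    : set 'cV[R[i]]_m :=
  range (fun v : 'cV[R[i]]_n => X *m v).

Definition mx_inner (R : realType) (n : nat) (C D : 'M[R[i]]_n) : R[i] :=
  \tr (C *m D ^t*).

Definition mx_orthonormal (R : realType) (n r : nat)
    (g : 'I_r -> 'M[R[i]]_n) : Prop :=
  forall i j : 'I_r, mx_inner (g i) (g j) = (i == j)%:R.

(* [g *t d] is the Kronecker product. *)
Definition hermitian_schmidt (R : realType) (k m r : nat)
    (A : 'M[R[i]]_(k * m)) (lambda : 'I_r -> R)
    (g : 'I_r -> 'M[R[i]]_k) (d : 'I_r -> 'M[R[i]]_m) : Prop :=
  [/\ forall i, 0 < lambda i,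
      (forall i, g i \is hermsymmx) /\ mx_orthonormal g,
      (forall i, d i \is hermsymmx) /\ mx_orthonormal d
    & A = \sum_(i < r) (lambda i)%:C *: (g i *t d i)].

Definition weak_irreducible (R : realType) (k m : nat)
    (A : 'M[R[i]]_(k * m)) : Prop :=
  forall (V1 V2 : 'M[R[i]]_k) (W1 W2 : 'M[R[i]]_m),
    hermitian_projection V1 -> hermitian_projection V2 ->
    hermitian_projection W1 -> hermitian_projection W2 ->
    V1 *m V2 = 0 -> W1 *m W2 = 0 ->
    V1 + V2 = 1%:M -> W1 + W2 = 1%:M ->
    A = (V1 *t W1) *m A *m (V1 *t W1) + (V2 *t W2) *m A *m (V2 *t W2) ->
    (V1 *t W1) *m A *m (V1 *t W1) = 0 \/ (V2 *t W2) *m A *m (V2 *t W2) = 0.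

(* Main.v *)
(** Cutting the decomposition of [A] by [V1] on the first factor, or by [W1] on
    the second, yields the same matrix, namely
    [(V1 *t W1) *m A *m (V1 *t W1)].  Writing [P] and [Q] for the (symmetric)
    matrices of the compressions by [V1] and [W1] in the Schmidt families, this
    says [lambda j * P j l = lambda l * Q l j]; hence
    [lambda j ^ 2 * P j l = lambda l ^ 2 * P j l], and the spectral gap makes
    [V1 *m gamma ord0 *m V1] a multiple of [gamma ord0].  So [V1] or [V2] kills
    [gamma ord0], and by the inclusion of images it kills every [gamma i]. *)
Require Import Defs.
From mathcomp Require Import all_boot all_order all_algebra.
From mathcomp Require Import complex mxtens.
From mathcomp Require Import classical_sets reals.

Local Open Scope ring_scope.
Local Open Scope complex_scope.
Local Open Scope classical_set_scope.

Import Order.TTheory GRing.Theory Num.Theory.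

(* The partial trace over the second factor of [M *m (1%:M *t D)]. *)
Definition contract (F : comNzRingType) (k m : nat) (D : 'M[F]_m)
    (M : 'M[F]_(k * m)) : 'M[F]_k :=
  \matrix_(a, b) \sum_p \sum_q
    M (mxtens_index (a, p)) (mxtens_index (b, q)) * D q p.

Arguments contract {F k m} D M.

(** When the [Y i] are trace-orthonormal, taking [D] among them isolates a single [X i]; this reads
    off coefficients on the first factor. *)
Lemma contract_sum_tens (F : comNzRingType) (k m r : nat) (c : 'I_r -> F)
    (X : 'I_r -> 'M[F]_k) (Y : 'I_r -> 'M[F]_m) (D : 'M[F]_m) :
  contract D (\sum_i c i *: (X i *t Y i)) =
  \sum_i (c i * \tr (Y i *m D)) *: X i.
Proof.
apply/matrixP => a b; rewrite !mxE summxE.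
under eq_bigr => p _ do under eq_bigr => q _ do rewrite summxE mulr_suml.
under eq_bigr => p _ do rewrite exchange_big /=.
rewrite exchange_big /=; apply: eq_bigr => i _.
rewrite mxE /mxtrace mulr_sumr mulr_suml; apply: eq_bigr => p _.
rewrite mxE mulr_sumr mulr_suml; apply: eq_bigr => q _.
by rewrite !mxE !mxtens_indexK /= -!mulrA; congr (_ * _); rewrite mulrC mulrA.
Qed.

Lemma mulmx_sum_tens (F : comNzRingType) (k m r : nat) (c : 'I_r -> F)
    (X : 'I_r -> 'M[F]_k) (Y : 'I_r -> 'M[F]_m)
    (V V' : 'M[F]_k) (W W' : 'M[F]_m) :
  (V *t W) *m (\sum_i c i *: (X i *t Y i)) *m (V' *t W') =
  \sum_i c i *: ((V *m X i *m V') *t (W *m Y i *m W')).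
Proof.
rewrite mulmx_sumr mulmx_suml; apply: eq_bigr => i _.
by rewrite -scalemxAr -scalemxAl !tensmx_mul.
Qed.

Lemma mxtrace_compression (F : comNzRingType) (k : nat) (V X Y : 'M[F]_k) :
  \tr (V *m X *m V *m Y) = \tr (V *m Y *m V *m X).
Proof. by rewrite -mulmxA mxtrace_mulC mulmxA. Qed.

Lemma mx_inner_herm (R : realType) (n : nat) (C D : 'M[R[i]]_n) :
  D \is hermsymmx -> mx_inner C D = \tr (C *m D).
Proof.
by move=> /is_hermitianmxP; rewrite expr0 scale1r /mx_inner => <-.
Qed.

(** Every column of [X] has the form [Y *m w], and [V] kills it. *)
Lemma mulmx_image_eq0 (R : realType) (k : nat) (V X Y : 'M[R[i]]_k) :
  mx_image X `<=` mx_image Y -> V *m Y = 0 -> V *m X = 0.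
Proof.
move=> sXY VY0; apply/matrixP => a b.
have [w _ Yw] : mx_image Y (X *m delta_mx b (0 : 'I_1)).
  by apply: sXY; exists (delta_mx b 0).
have : V *m (X *m delta_mx b (0 : 'I_1)) = 0 by rewrite -Yw mulmxA VY0 mul0mx.
by move/matrixP/(_ a 0); rewrite mulmxA -colE !mxE.
Qed.
Arguments mulmx_image_eq0 {R k V X Y}.

Theorem theorem3p2 (R : realType) (k m n : nat) (A : 'M[R[i]]_(k * m))
    (lambda : 'I_n.+1 -> R)
    (gamma : 'I_n.+1 -> 'M[R[i]]_k) (delta : 'I_n.+1 -> 'M[R[i]]_m)
    (hA : psd_hermitian A)
    (hS : hermitian_schmidt A lambda gamma delta)
    (hmono : forall i j : 'I_n.+1, (i <= j)%N -> lambda j <= lambda i)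
    (hgap : forall i : 'I_n.+1, i != ord0 -> lambda i < lambda ord0)
    (hgamma : forall i : 'I_n.+1, mx_image (gamma i) `<=` mx_image (gamma ord0))
    (hdelta : forall i : 'I_n.+1, mx_image (delta i) `<=` mx_image (delta ord0)) :
  weak_irreducible A.
Proof.
case: hS => lam_gt0 [gH gO] [dH dO] AE.
move=> V1 V2 W1 W2 [_ V1V1] [_ V2V2] [_ W1W1] [_ W2W2] V12 W12 V12s W12s Adec.
pose L i := (lambda i)%:C.
have lam_neq0 i : L i != 0.
  by rewrite (inj_eq (@complexI R)) gt_eqF.
have V21 : V2 *m V1 = 0.
  by rewrite -[V2 in LHS](addKr V1) V12s mulmxDl mulNmx V1V1 mul1mx addNr.
have W21 : W2 *m W1 = 0.
  by rewrite -[W2 in LHS](addKr W1) W12s mulmxDl mulNmx W1W1 mul1mx addNr.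
have gT i j : \tr (gamma i *m gamma j) = (i == j)%:R.
  by rewrite -mx_inner_herm.
have dT i j : \tr (delta i *m delta j) = (i == j)%:R.
  by rewrite -mx_inner_herm.
have cut (V V' : 'M[R[i]]_k) (W W' : 'M[R[i]]_m) : (V *t W) *m A *m (V' *t W') =
    \sum_i L i *: ((V *m gamma i *m V') *t (W *m delta i *m W')).
  by rewrite AE mulmx_sum_tens.
have decomp (V V' : 'M[R[i]]_k) (W W' : 'M[R[i]]_m) : (V *t W) *m A *m (V' *t W') =
    ((V *m V1) *t (W *m W1)) *m A *m ((V1 *m V') *t (W1 *m W')) +
    ((V *m V2) *t (W *m W2)) *m A *m ((V2 *m V') *t (W2 *m W')).
  by rewrite {1}Adec mulmxDr mulmxDl -!tensmx_mul !mulmxA.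
have kill V W : V *m gamma ord0 = 0 -> (V *t W) *m A *m (V *t W) = 0.
  move=> V0; rewrite cut big1 // => i _.
  by rewrite (mulmx_image_eq0 (hgamma i) V0) mul0mx tens0mx scaler0.
(* On either side, [decomp] leaves the block of index 1 intact, while the other block contains
   [V1 *m V2] or [W1 *m W2]. *)
have swap : (V1 *t 1%:M) *m A *m (V1 *t 1%:M) =
            (1%:M *t W1) *m A *m (1%:M *t W1).
  rewrite [LHS]decomp [RHS]decomp !(V1V1, W1W1, V12, W12, V21, W21, mul1mx, mulmx1).
  by rewrite !(tens0mx, tensmx0, mul0mx).
pose P i j := \tr (V1 *m gamma i *m V1 *m gamma j).
pose Q i j := \tr (W1 *m delta i *m W1 *m delta j).
(* Contract [swap] with [delta j]: orthonormality keeps one term on the left, and the traces on the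
   right are the [Q i j]. *)
have compress j :
    L j *: (V1 *m gamma j *m V1) = \sum_i (L i * Q i j) *: gamma i.
  have := congr1 (contract (delta j)) swap.
  rewrite !cut !contract_sum_tens (bigD1 j) //= big1 ?addr0 => [|i /negPf ij].
    rewrite mul1mx mulmx1 dT eqxx mulr1 => ->.
    by apply: eq_bigr => i _; rewrite mul1mx mulmx1.
  by rewrite mul1mx mulmx1 dT ij mulr0 scale0r.
have PQ j l : L j * P j l = L l * Q l j.
  have := congr1 (fun M => \tr (M *m gamma l)) (compress j).
  rewrite /= -scalemxAl mxtraceZ mulmx_suml raddf_sum (bigD1 l) //=.
  rewrite big1 => [|i /negPf il].
    by rewrite addr0 -scalemxAl mxtraceZ gT eqxx mulr1.
  by rewrite -scalemxAl mxtraceZ gT il mulr0.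
have Psym j l : P j l = P l j by apply: mxtrace_compression.
have Qsym j l : Q j l = Q l j by apply: mxtrace_compression.
have Q0 i : i != ord0 -> Q i ord0 = 0.
  move=> i0.
  (* Apply [PQ] to [(i, ord0)] and to [(ord0, i)], with the symmetry of [P] and [Q] in between. *)
  have e : (L ord0 ^+ 2 - L i ^+ 2) * Q i ord0 = 0.
    apply/eqP; rewrite mulrBl subr_eq0 !expr2 -!mulrA [in eqbLHS]Qsym.
    by rewrite -(PQ i ord0) mulrCA Psym PQ.
  move/eqP: e; rewrite mulf_eq0 => /orP[|/eqP//].
  rewrite subr_eq0 -!rmorphXn (inj_eq (@complexI R)) => /eqP e.
  have := hgap _ i0; rewrite -(ltr_pXn2r (isT : (0 < 2)%N)) ?nnegrE ?ltW //.
  by rewrite e ltxx.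
have eig : V1 *m gamma ord0 *m V1 = Q ord0 ord0 *: gamma ord0.
  apply: (scalerI (lam_neq0 ord0)); rewrite compress scalerA (bigD1 ord0) //=.
  by rewrite big1 ?addr0 // => i i0; rewrite Q0 // mulr0 scale0r.
(* [A] has no block between [V1] and [V2]; contracting with [delta ord0] passes this on to
   [gamma ord0]. *)
have off : V1 *m gamma ord0 *m V2 = 0.
  have : (V1 *t 1%:M) *m A *m (V2 *t 1%:M) = 0.
    by rewrite decomp V12 !(tens0mx, mul0mx, mulmx0) addr0.
  move/(congr1 (contract (delta ord0))); rewrite cut contract_sum_tens.
  rewrite (bigD1 ord0) //= big1 => [|i /negPf i0]; last first.
    by rewrite mul1mx mulmx1 dT i0 mulr0 scale0r.
  have -> : contract (delta ord0) (0 : 'M_(k * m)) = 0.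
    apply/matrixP => a b; rewrite !mxE big1 // => p _.
    by rewrite big1 // => q _; rewrite mxE mul0r.
  rewrite addr0 mul1mx mulmx1 dT eqxx mulr1 => /eqP.
  by rewrite scaler_eq0 (negPf (lam_neq0 _)) => /eqP.
(* If the factor in [eig] is zero, [eig] and [off] add up to [V1 *m gamma ord0 = 0]. Otherwise
   [gamma ord0] is a multiple of [V1 *m gamma ord0 *m V1], which [V2] kills from the left. *)
have [c0|c0] := eqVneq (Q ord0 ord0) 0.
  left; apply: kill.
  by rewrite -[LHS]mulmx1 -V12s mulmxDr off eig c0 scale0r addr0.
right; apply: kill; apply: (scalerI c0).
by rewrite scalemxAr -eig !mulmxA V21 !mul0mx scaler0.
Qed.
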